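(* Let $N,D\ge 1$ be integers and $W_Q,W_K,W_V\in\mathbb{R}^{D\times D}$. For $X\in\mathbb{R}^{N\times D}$ let $Q=XW_Q$, $K=XW_K$, $V=XW_V$, and suppose all columns of $Q$ and $K$ are nonzero. Let $O=\hat Q\,\hat K^T\,V$ be the output of SimA, where $\hat Q$ and $\hat K$ are obtained from $Q$ and $K$ by dividing each column by its $\ell_1$ norm. Then, for all $1\le m\le N$ and $1\le n\le D$, $O$ is a normalized homogeneous degree-$3$ polynomial in the entries of $X$, namely $$O_{m,n}=\sum_{i=1}^D\sum_{j=1}^N \frac{1}{\|Q^i\|_1\,\|K^i\|_1}\sum_{k_Q=1}^D\sum_{k_K=1}^D\sum_{k_V=1}^D [W_Q]_{k_Q,i}\,[W_K]_{k_K,i}\,[W_V]_{k_V,n}\; X_{m,k_Q}\,X_{j,k_K}\,X_{j,k_V}.$$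
   Context: For a matrix $M$, $M^i$ denotes its $i$-th column, and $\|\cdot\|_1$ is the $\ell_1$ norm. Thus $\hat Q^i=Q^i/\|Q^i\|_1$ and $\hat K^i=K^i/\|K^i\|_1$. ''Normalized'' means that the cubic monomials appear with coefficients that are polynomial in the weights divided by the normalization factors $\|Q^i\|_1\|K^i\|_1$ (which themselves depend on $X$). *)

(* Defs.v *)
From mathcomp Require Import all_boot all_order all_algebra.
From mathcomp Require Import reals.
From mathcomp Require Import mpoly.

Set Implicit Arguments.
Unset Strict Implicit.
Unset Printing Implicit Defensive.

Import GRing.Theory Num.Theory.
Local Open Scope ring_scope.

Definition l1norm (R : realType) (N : nat) (v : 'cV[R]_N) : R :=
  \sum_(j < N) `|v j 0|.

Definition l1_normalize (R : realType) (N D : nat) (M : 'M[R]_(N, D)) :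
    'M[R]_(N, D) :=
  \matrix_(j, i) (M j i / l1norm (col i M)).

Definition nonzero_cols (R : realType) (N D : nat) (M : 'M[R]_(N, D)) : Prop :=
  forall i : 'I_D, col i M <> 0.

Definition simA (R : realType) (N D : nat) (WQ WK WV : 'M[R]_D)
    (X : 'M[R]_(N, D)) : 'M[R]_(N, D) :=
  l1_normalize (X *m WQ) *m (l1_normalize (X *m WK))^T *m (X *m WV).

(* The entries of the three weight matrices, as one vector of values for the
   weight variables. *)
Definition weight_vec (R : realType) (D : nat) (WQ WK WV : 'M[R]_D) :
    'I_(D * D + D * D + D * D) -> R :=
  fun k => row_mx (row_mx (mxvec WQ) (mxvec WK)) (mxvec WV) 0 k.

(* [F WQ WK WV X] is a normalized homogeneous polynomial of degree [d] in the
   entries of [X]: a sum over [i] of homogeneous forms of degree [d] in the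
   entries of [X], the [i]-th one divided by the normalization factor
   |Q^i|_1 |K^i|_1.  The form [p i] has coefficients in the ring of polynomials
   in the weights; it depends neither on the weights nor on [X], so [X] enters
   the coefficients of [F] only through the normalization factors. *)
Definition normalized_homogeneous (R : realType) (N D d : nat)
    (F : 'M[R]_D -> 'M[R]_D -> 'M[R]_D -> 'M[R]_(N, D) -> R) : Prop :=
  exists p : 'I_D ->
      {mpoly {mpoly R[D * D + D * D + D * D]}[N * D]},
    (forall i, p i \is d.-homog) /\
    (forall (WQ WK WV : 'M[R]_D) (X : 'M[R]_(N, D)),
       nonzero_cols (X *m WQ) -> nonzero_cols (X *m WK) ->
       F WQ WK WV X =
       \sum_(i < D)
         (l1norm (col i (X *m WQ)) * l1norm (col i (X *m WK)))^-1 *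
         (map_mpoly (meval (weight_vec WQ WK WV)) (p i)).@[fun k => mxvec X 0 k]).

(* Main.v *)
Require Import Defs.
From mathcomp Require Import all_boot all_order all_algebra.
From mathcomp Require Import reals.
From mathcomp Require Import mpoly.

Import GRing.Theory Num.Theory.
Local Open Scope ring_scope.

(** Every entry of [X W] is a linear form in the entries of [X] whose
coefficients are entries of [W].  Factoring the normalization out of [O_(m,n)]
leaves [\sum_j Q_(m,i) K_(j,i) V_(j,n)], a sum of products of three such
forms. *)

(* The entry [(r, c)] of [X *m W] as a polynomial in the entries of [X], when
   [w k] is the number of the weight variable that stands for [W k c]. *)
Definition linear_form {R : realType} {N D M : nat} (w : 'I_D -> 'I_M)
    (r : 'I_N) : {mpoly {mpoly R[M]}[N * D]} :=
  \sum_(k < D) 'X_(w k) *: 'X_(mxvec_index r k).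

Lemma linear_form_homog (R : realType) (N D M : nat) (w : 'I_D -> 'I_M)
    (r : 'I_N) : (linear_form w r : {mpoly {mpoly R[M]}[N * D]}) \is 1.-homog.
Proof.
apply: rpred_sum => k _; apply: dhomogZ.
by rewrite dhomogX /= mdeg1.
Qed.

(** Evaluation has two stages: [map_mpoly] specializes the weight variables inside the coefficients,
    then the outer evaluation substitutes the entries of [X]. *)
Lemma linear_form_eval (R : realType) (N D M : nat) (w : 'I_D -> 'I_M)
    (v : 'I_M -> R) (W : 'M[R]_D) (X : 'M[R]_(N, D)) (r : 'I_N) (c : 'I_D) :
  (forall k, v (w k) = W k c) ->
  (map_mpoly (meval v) (linear_form w r)).@[fun k => mxvec X 0 k] =
    (X *m W) r c.
Proof.
move=> vw; rewrite mxE /linear_form [map_mpoly _ _]raddf_sum raddf_sum /=.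
apply: eq_bigr => k _.
by rewrite map_mpolyZ map_mpolyX mevalZ /= !mevalXU vw mxvecE mulrC.
Qed.

(** Both norms depend only on the column [i], so once the sum over [i] is outermost they leave the
    sum over [j]. Both halves of the theorem start from this form. *)
Lemma simA_entry (R : realType) (N D : nat) (WQ WK WV : 'M[R]_D)
    (X : 'M[R]_(N, D)) (m : 'I_N) (n : 'I_D) :
  simA WQ WK WV X m n =
  \sum_(i < D)
    (l1norm (col i (X *m WQ)) * l1norm (col i (X *m WK)))^-1 *
    \sum_(j < N) (X *m WQ) m i * (X *m WK) j i * (X *m WV) j n.
Proof.
rewrite /simA /l1_normalize mxE.
under eq_bigr => j _ do rewrite mxE mulr_suml.
rewrite exchange_big /=; apply: eq_bigr => i _.
rewrite mulr_sumr; apply: eq_bigr => j _.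
rewrite [in LHS]mxE [X in _ * X * _]mxE [X in _ * X * _]mxE.
by rewrite mulrACA -invfM [_ / _]mulrC -!mulrA.
Qed.

Lemma mulmx3_expand (R : comPzRingType) (N D : nat) (WQ WK WV : 'M[R]_D)
    (X : 'M[R]_(N, D)) (m j : 'I_N) (i n : 'I_D) :
  (X *m WQ) m i * (X *m WK) j i * (X *m WV) j n =
  \sum_(kQ < D) \sum_(kK < D) \sum_(kV < D)
    WQ kQ i * WK kK i * WV kV n * X m kQ * X j kK * X j kV.
Proof.
rewrite !mxE !mulr_suml; apply: eq_bigr => kQ _.
rewrite -mulrA mulr_suml mulr_sumr; apply: eq_bigr => kK _.
rewrite !mulr_sumr; apply: eq_bigr => kV _.
(* With the weight first in each factor, two interchanges gather the three weights on the left. *)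
rewrite [X m kQ * _]mulrC [X j kK * _]mulrC [X j kV * _]mulrC.
by rewrite [WK kK i * _ * _]mulrACA [LHS]mulrACA !mulrA.
Qed.

Theorem mainTheorem5 (R : realType) (N D : nat) (hN : (1 <= N)%N)
    (hD : (1 <= D)%N) :
  (forall (m : 'I_N) (n : 'I_D),
     normalized_homogeneous 3
       (fun (WQ WK WV : 'M[R]_D) (X : 'M[R]_(N, D)) => simA WQ WK WV X m n)) /\
  (forall (WQ WK WV : 'M[R]_D) (X : 'M[R]_(N, D)),
     nonzero_cols (X *m WQ) -> nonzero_cols (X *m WK) ->
     forall (m : 'I_N) (n : 'I_D),
     simA WQ WK WV X m n =
     \sum_(i < D) \sum_(j < N)
       1 / (l1norm (col i (X *m WQ)) * l1norm (col i (X *m WK))) *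
       \sum_(kQ < D) \sum_(kK < D) \sum_(kV < D)
         WQ kQ i * WK kK i * WV kV n * X m kQ * X j kK * X j kV).
Proof.
split=> [m n | WQ WK WV X _ _ m n]; last first.
  rewrite simA_entry; apply: eq_bigr => i _.
  rewrite mulr_sumr; apply: eq_bigr => j _.
  by rewrite mulmx3_expand div1r.
(* Positions of [WQ k i], [WK k i] and [WV k i] in the block layout of [weight_vec]. *)
pose wQ i k : 'I_(D * D + D * D + D * D) := lshift _ (lshift _ (mxvec_index k i)).
pose wK i k : 'I_(D * D + D * D + D * D) := lshift _ (rshift _ (mxvec_index k i)).
pose wV i k : 'I_(D * D + D * D + D * D) := rshift _ (mxvec_index k i).
(* The inner sum of [simA_entry], with each matrix entry replaced by its linear form. *)
exists (fun i => \sum_(j < N) linear_form (wQ i) m *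
  linear_form (wK i) j * linear_form (wV n) j).
split=> [i | WQ WK WV X _ _].
  apply: rpred_sum => j _.
  apply: (@dhomogM _ _ _ 2%N _ 1%N); last exact: linear_form_homog.
  by apply: (@dhomogM _ _ _ 1%N _ 1%N); exact: linear_form_homog.
rewrite simA_entry; apply: eq_bigr => i _; congr (_ * _).
(* Both evaluation stages are ring morphisms, so they reach each linear form separately. *)
rewrite [map_mpoly _ _]raddf_sum raddf_sum /=; apply: eq_bigr => j _.
rewrite !rmorphM /=.
rewrite (@linear_form_eval _ _ _ _ _ _ WQ _ _ i); last first.
  by move=> k; rewrite /weight_vec !row_mxEl mxvecE.
rewrite (@linear_form_eval _ _ _ _ _ _ WK _ _ i); last first.
  by move=> k; rewrite /weight_vec row_mxEl row_mxEr mxvecE.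
rewrite (@linear_form_eval _ _ _ _ _ _ WV _ _ n) //.
by move=> k; rewrite /weight_vec row_mxEr mxvecE.
Qed.
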